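(* Let $k$ be a natural number. For all $n\geq 2^{k-1}k(2k-1)$, $$A_{2k}(n)=B_k^e(n)-B_k^o(n)=C_k^e(n+1)-C_k^o(n+1)=\tfrac12 D_{2k}(n+1).$$
   Context: All partitions are into positive parts unless stated otherwise. $A_{j}(n):=\tfrac12\big(P_1(d,n)+P'_{j-1}(d,n)+P_2(d,n)+P''_{j-1}(d,n)\big)$, where the terms are defined as follows. - $P_1(d,n)$ counts partitions of $n$ into distinct parts with smallest part exceeding $1$. - $P_2(d,n)$ counts partitions of $n$ into distinct parts whose two smallest parts differ by at least $2$ (single-part partitions count vacuously). - $P'_{j-1}(d,n)$ counts partitions of $n$ with all parts distinct except that the smallest part is $1$ with multiplicity $j-1$. - $P''_{j-1}(d,n)$ counts partitions of $n$ into distinct parts except that the second smallest part appears with multiplicity $j-1$, where the two smallest parts differ by $1$. $B_k^e(n)$ (resp. $B_k^o(n)$) is the number of partitions of $n$ having at least one odd part, with largest odd part $2\ell-1$, all of whose parts are odd except for at most $k-1$ pairwise distinct even parts in $[2\ell+2,2\ell+2k-2]$, the number of which is even (resp. odd). $C_k^e(n)$ (resp. $C_k^o(n)$) is the number of pairs $(\lambda,\ell)$ with $\ell\ge1$ and $\lambda$ a partition of $n$ satisfying three conditions: - $\lambda$ contains the part $2\ell$; - the parts not exceeding $\ell$ are distinct, while parts in $(\ell,2\ell]$ are unrestricted; - the parts larger than $2\ell$ are at most $k-1$ distinct even parts in $[2\ell+2,2\ell+2k-2]$, their number being even (resp. odd). Thus a partition is counted once per admissible $\ell$. $D_j(n)$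 counts partitions of $n$ into non-negative parts (part $0$ allowed) in which the smallest part appears exactly $j$ times and no other part repeats, with $D_j(0)=1$. Its generating function is $\sum_n D_j(n)q^n=\sum_{m\ge0}q^{mj}(-q^{m+1};q)_\infty$. *)

(* Defs.v *)
From mathcomp Require Import all_boot all_order all_algebra.
Set Implicit Arguments. Unset Strict Implicit. Unset Printing Implicit Defensive.
Import GRing.Theory Num.Theory.

(* A partition (into non-negative parts, multiset of nats) is encoded by its
   multiplicity function  m : {ffun 'I_N -> 'I_M}, m i = multiplicity of the
   part i.  [mparts m] lists the parts in INCREASING order, with repetition. *)
Definition mparts (N M : nat) (m : {ffun 'I_N -> 'I_M}) : seq nat :=
  flatten [seq nseq (m i) (i : nat) | i <- enum 'I_N].

(* Number of partitions of n into POSITIVE parts whose (increasing) list of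
   parts satisfies P.  Parts and multiplicities of a partition of n into
   positive parts are at most n, so 'I_n.+1 suffices for both. *)
Definition pcount (n : nat) (P : pred (seq nat)) : nat :=
  #|[set m : {ffun 'I_n.+1 -> 'I_n.+1} |
      (val (m ord0) == 0) && (\sum_(i < n.+1) i * m i == n) && P (mparts m)]|.

Definition pcount0 (n b : nat) (P : pred (seq nat)) : nat :=
  #|[set m : {ffun 'I_n.+1 -> 'I_(n + b).+1} |
      (\sum_(i < n.+1) i * m i == n) && P (mparts m)]|.

Definition P1_cond : pred (seq nat) := fun s => uniq s && (1 \notin s).
Definition P2_cond : pred (seq nat) := fun s =>
  uniq s && (if s is a :: b :: _ then a + 2 <= b else true).
Definition P'_cond (j : nat) : pred (seq nat) := fun s =>
  (count_mem 1 s == j - 1) && uniq [seq x <- s | 1 < x].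
Definition P''_cond (j : nat) : pred (seq nat) := fun s =>
  if s is a :: r then
    (take (j - 1) r == nseq (j - 1) a.+1) && uniq (drop (j - 1) r)
    && all (fun x => a.+1 < x) (drop (j - 1) r)
  else false.

Definition A (j n : nat) : rat :=
  (pcount n P1_cond + pcount n (P'_cond j) + pcount n P2_cond
     + pcount n (P''_cond j))%:R / 2.

Definition B_cond (k : nat) (par : bool) : pred (seq nat) := fun s =>
  let two_l := (\max_(x <- s | odd x) x).+1 in
  let ev := [seq x <- s | ~~ odd x] in
  has odd s && uniq ev
  && all (fun x => (two_l + 2 <= x) && (x <= two_l + 2 * k - 2)) ev
  && (odd (size ev) == par).

Definition B (k : nat) (par : bool) (n : nat) : nat := pcount n (B_cond k par).

Definition C_cond (k l : nat) (par : bool) : pred (seq nat) := fun s =>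
  let big := [seq x <- s | 2 * l < x] in
  (2 * l \in s) && uniq [seq x <- s | x <= l]
  && uniq big
  && all (fun x => ~~ odd x && (2 * l + 2 <= x) && (x <= 2 * l + 2 * k - 2)) big
  && (odd (size big) == par).

(* pairs (lambda, l) with l >= 1; only l with 2l <= n can contribute *)
Definition C (k : nat) (par : bool) (n : nat) : nat :=
  \sum_(1 <= l < n.+1) pcount n (C_cond k l par).

(* ---------- D_j ---------- smallest part appears exactly j times, no other
   part repeats (part 0 allowed).  Multiplicities are <= max(n, j) <= n + j. *)
Definition D_cond (j : nat) : pred (seq nat) := fun s =>
  if s is a :: _ then (count_mem a s == j) && uniq [seq x <- s | a < x]
  else false.

Definition D (j n : nat) : nat := pcount0 n j (D_cond j).

(* Main.v *)
Require Import Defs.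
From mathcomp Require Import all_boot all_order all_algebra.
From mathcomp Require Import ring zify.
Set Implicit Arguments. Unset Strict Implicit. Unset Printing Implicit Defensive.
Import GRing.Theory Num.Theory.

(** Let [D_j = sum_(m >= 0) q^(mj) (-q^(m+1);q)_oo] and
    [G_k = sum_(l >= 1) q^(2l) (q^(2l+2);q^2)_(k-1) / (q;q^2)_l].  Then [D_j] is
    the generating function of the paper's [D_j], and [G_k] is that of
    [C_k^e - C_k^o] (because [(-q)_l / (q^(l+1))_l = 1 / (q;q^2)_l]) as well as
    [q] times that of [B_k^e - B_k^o].  Moreover [2 q A_j = D_j - 1 + q].
    With [j = 2k], both [D_2k] and [2 G_k] satisfy
      [Y_(k+1) = (1 - q^(2k)) (1 - q^(2k+1)) Y_k + 2 q^(2k+1) (-q)_oo + error],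
    with no error for [D] and error [- 2 q^(2k+1) (q^2;q^2)_k] for [2 G].  Hence
    [D_2k - 2 G_k] is a polynomial, of degree at most [k (2k - 1)], and the
    coefficients agree beyond that degree.

    The power series are replaced by elements of a commutative ring in which
    [x] is nilpotent, so that all sums and products are finite and [1 - x^i] is
    invertible. *)

(** * q-series in a nilpotent variable *)

Section NilpotentQSeries.

Local Open Scope ring_scope.
Variables (R : comNzRingType) (x : R) (N M : nat).
Hypotheses (xN0 : x ^+ N = 0) (leNM : (N <= M)%N) (N_gt0 : (0 < N)%N).

Lemma exprN0 i : (N <= i)%N -> x ^+ i = 0.
Proof. by move=> Ni; rewrite -(subnKC Ni) exprD xN0 mul0r. Qed.

(** The inverse of [1 - x^i] for [i > 0]: cutting the geometric series at [M >= N] only drops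
    vanishing terms. *)
Definition geo i := \sum_(c < M) x ^+ (i * c).

Lemma geoK i : (0 < i)%N -> (1 - x ^+ i) * geo i = 1.
Proof.
move=> i_gt0; rewrite /geo.
under eq_bigr do rewrite exprM.
rewrite -[1 - _]opprB mulNr -subrX1 opprB -exprM exprN0 ?subr0 //.
by rewrite (leq_trans leNM) // leq_pmull.
Qed.

Lemma geo1 i : (N <= i)%N -> geo i = 1.
Proof.
move=> Ni; have := geoK (leq_trans N_gt0 Ni).
by rewrite exprN0 // subr0 mul1r.
Qed.

Definition distinct a := \prod_(a <= i < M) (1 + x ^+ i).

Lemma distinctS a : distinct a = (1 + x ^+ a) * distinct a.+1.
Proof.
rewrite /distinct; have [aM|Ma] := ltnP a M; first by rewrite big_ltn.
by rewrite !big_geq ?(leqW Ma) // exprN0 ?addr0 ?mulr1 // (leq_trans leNM).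
Qed.

Lemma distinct1 a : (N <= a)%N -> distinct a = 1.
Proof.
move=> Na; rewrite /distinct big_nat big1 // => i /andP[ai _].
by rewrite exprN0 ?addr0 // (leq_trans Na).
Qed.

Definition Dseries j := \sum_(0 <= m < N) x ^+ (m * j) * distinct m.+1.

(** Telescoping: [x^m * distinct m.+1 = distinct m - distinct m.+1], and
    [distinct 0 = 2 * distinct 1] because the factor at [i = 0] is 2. *)
Lemma Fser1 : Dseries 1 = 2 * distinct 1 - 1.
Proof.
rewrite /Dseries (@telescope_sumr_eq _ _ _ (fun m => - distinct m)) // => [|m _].
  by rewrite distinct1 // distinctS expr0; ring.
by rewrite muln1 (distinctS m); ring.
Qed.

(** In [D_j + D_(j+1)] the factor [1 + x^m] completes [distinct m.+1] to [distinct m]. The terms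
    with [m > 0] are then, after a shift, those of [x^j D_j], and [m = 0] gives [2 * distinct 1]. *)
Lemma DseriesS j : (0 < j)%N -> Dseries j.+1 = 2 * distinct 1 - (1 - x ^+ j) * Dseries j.
Proof.
move=> j_gt0; suff: Dseries j + Dseries j.+1 = 2 * distinct 1 + x ^+ j * Dseries j.
  by move=> e; rewrite mulrBl mul1r opprB addrA [_ + _]addrC -e; ring.
rewrite /Dseries -big_split /=.
transitivity (\sum_(0 <= m < N) x ^+ (m * j) * distinct m).
  by apply: eq_bigr => m _; rewrite (distinctS m) mulnS exprD; ring.
rewrite -(prednK N_gt0) [LHS]big_nat_recl // mul0n expr0 mul1r (distinctS 0) expr0.
rewrite [in RHS]big_nat_recr //= mulrDr mulrA -exprD -mulSn prednK //.
rewrite (@exprN0 (N * j)) ?leq_pmulr // mul0r addr0 mulr_sumr; congr (_ + _).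
by apply: eq_bigr => i _; rewrite mulrA -exprD -mulSn.
Qed.

Lemma DseriesSS j : (0 < j)%N ->
  Dseries j.+2 = 2 * x ^+ j.+1 * distinct 1 + (1 - x ^+ j) * (1 - x ^+ j.+1) * Dseries j.
Proof. by move=> j0; rewrite DseriesS // DseriesS //; ring. Qed.

Definition odds l := \prod_(i < l) geo (2 * i).+1.

(* [1 / (q;q^2)_l = (-q)_l / (q^(l+1))_l]; Euler's identity is the limit case
   [odds_distinct]. *)
Lemma oddsE l :
  odds l = \prod_(1 <= i < l.+1) (1 + x ^+ i) * \prod_(l.+1 <= i < (2 * l).+1) geo i.
Proof.
elim: l => [|l IHl]; first by rewrite /odds big_ord0 !big_geq ?mulr1.
rewrite /odds big_ord_recr /= -/(odds l) IHl.
have e2 : (2 * l.+1 = (2 * l).+2)%N by lia.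
(* Raising [l] by one brings in [1 + x^(l+1)], [geo (2l+1)] and [geo (2l+2)] and removes
   [geo (l+1)]; as [1 - x^(2l+2) = (1 - x^(l+1)) (1 + x^(l+1))], all but [geo (2l+1)] cancels. *)
have g2 : (1 + x ^+ l.+1) * ((1 - x ^+ l.+1) * geo (2 * l).+2) = 1.
  rewrite mulrA -e2 -[RHS](@geoK (2 * l.+1)) //; congr (_ * _).
  by rewrite mulnC exprM; ring.
have e3 : geo l.+1 * \prod_(l.+2 <= i < (2 * l).+3) geo i =
          \prod_(l.+1 <= i < (2 * l).+1) geo i * (geo (2 * l).+1 * geo (2 * l).+2).
  rewrite -big_ltn; last by lia.
  rewrite (big_nat_recr (2 * l).+2) /=; last by lia.
  by rewrite (big_nat_recr (2 * l).+1) /= ?mulrA //; lia.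
rewrite (big_nat_recr l.+1) //= e2.
set P := \prod_(1 <= i < _) _; set Q := \prod_(l.+1 <= i < _) _ in e3 *.
set S := \prod_(l.+2 <= i < _) _ in e3 *.
have -> : P * (1 + x ^+ l.+1) * S =
   P * (1 + x ^+ l.+1) * (1 - x ^+ l.+1) * (geo l.+1 * S).
  by rewrite -[LHS]mulr1 -[X in _ * X](@geoK l.+1) //; ring.
rewrite e3.
transitivity (P * Q * geo (2 * l).+1 * ((1 + x ^+ l.+1) * ((1 - x ^+ l.+1) * geo (2 * l).+2))).
  by rewrite g2 mulr1.
ring.
Qed.

Lemma odds_stable l d : (N <= (2 * l).+1)%N -> odds (l + d) = odds l.
Proof.
move=> Nl; elim: d => [|d IHd]; first by rewrite addn0.
by rewrite addnS /odds big_ord_recr /= -/(odds _) IHd geo1 ?mulr1 //; lia.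
Qed.

Lemma odds_distinct l : (N <= (2 * l).+1)%N -> odds l = distinct 1.
Proof.
(* With the index raised by [M], every factor [geo i] in [oddsE] has [i >= N] and is 1. *)
move=> Nl; rewrite -(odds_stable M Nl) oddsE.
rewrite [X in _ * X]big_nat [X in _ * X]big1 => [|i /andP[Mi _]]; last by rewrite geo1 //; lia.
rewrite mulr1 /distinct (@big_cat_nat _ _ _ M) //=; try lia.
rewrite [X in _ * X]big_nat [X in _ * X]big1 ?mulr1 // => i /andP[Mi _].
by rewrite exprN0 ?addr0 //; lia.
Qed.

(** The product [(q^(2l+2);q^2)_k]. *)
Definition evens l k := \prod_(l.+1 <= i < l.+1 + k) (1 - x ^+ (2 * i)).

(** This is [G_k] of the overview, cut at [N] since [x^(2l) = 0] from there on. *)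
Definition Cseries k := \sum_(1 <= l < N) x ^+ (2 * l) * (odds l * evens l k.-1).

Lemma evensS l k : evens l k.+1 = evens l k * (1 - x ^+ (2 * (l.+1 + k))).
Proof. by rewrite /evens addnS big_nat_recr //= leq_addr. Qed.

Lemma evensSl l k : evens l k.+1 = (1 - x ^+ (2 * l.+1)) * evens l.+1 k.
Proof. by rewrite /evens big_ltn ?addnS ?addSn // ltnS leq_addr. Qed.

(* The terms of [C_(k+1) - (1 - x^(2k)) (1 - x^(2k+1)) C_k] are
   [x^(2k+1)] times the increments of [l |-> odds l * evens l k]. *)
Lemma CseriesS k : (0 < k)%N ->
  Cseries k.+1 = (1 - x ^+ (2 * k)) * (1 - x ^+ (2 * k).+1) * Cseries k
              + x ^+ (2 * k).+1 * (distinct 1 - evens 0 k).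
Proof.
move=> k_gt0.
(* At [l = 0] the product of odd factors is empty and [evens 0 k] is left; at [l = N - 1] Euler's
   identity applies and [evens] is 1. *)
have tel : \sum_(1 <= l < N) (odds l * evens l k - odds l.-1 * evens l.-1 k)
           = distinct 1 - evens 0 k.
  have -> : \sum_(1 <= l < N) (odds l * evens l k - odds l.-1 * evens l.-1 k)
     = \sum_(0 <= l < N.-1) (odds l.+1 * evens l.+1 k - odds l * evens l k).
    by rewrite -{1}(prednK N_gt0) big_add1.
  rewrite telescope_sumr //; congr (_ - _); last first.
    by rewrite /odds big_ord0 mul1r.
  rewrite odds_distinct; last by lia.
  rewrite /evens big_nat big1 ?mulr1 // => i /andP[Ni _].
  by rewrite exprN0 ?subr0 //; lia.
rewrite -tel /Cseries !mulr_sumr -big_split /=; apply: eq_big_nat => -[//|l] _ /=.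
have odS : (1 - x ^+ (2 * l).+1) * odds l.+1 = odds l.
  by rewrite /odds big_ord_recr /= mulrCA geoK ?mulr1.
case: k k_gt0 {tel} => // k _ /=.
(* These rewrites make every term a multiple of [odds l.+1 * evens l.+1 k]; the cofactors satisfy a
   polynomial identity in powers of [x]. *)
rewrite -odS !(evensS l.+1) evensSl.
have -> : x ^+ (2 * (l.+2 + k)) = x ^+ (2 * l.+1) * x ^+ (2 * k.+1).
  by rewrite -exprD; congr (_ ^+ _); lia.
rewrite [x ^+ (2 * l.+1)](_ : _ = x * x ^+ (2 * l).+1); last by rewrite -exprS; congr (_ ^+ _); lia.
rewrite (exprS x (2 * k.+1)); ring.
Qed.

(** Again a telescope: [(1 - x^(2l+1)) odds (l+1) = odds l] makes [x^(2l+2) odds (l+1)] equal to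
    [x (odds (l+1) - odds l)]. *)
Lemma Gser1 : Cseries 1 = x * (distinct 1 - 1).
Proof.
have -> : distinct 1 - 1 = \sum_(0 <= l < N.-1) (odds l.+1 - odds l).
  rewrite telescope_sumr // odds_distinct; last by lia.
  by rewrite /odds big_ord0.
rewrite /Cseries -{1}(prednK N_gt0) big_add1 mulr_sumr.
apply: eq_big_nat => l _; rewrite /evens /= addn0 big_geq // mulr1.
have odS : (1 - x ^+ (2 * l).+1) * odds l.+1 = odds l.
  by rewrite /odds big_ord_recr /= mulrCA geoK ?mulr1.
rewrite -odS (_ : 2 * l.+1 = (2 * l).+2)%N ?exprS; last by lia.
ring.
Qed.

End NilpotentQSeries.

(** * The polynomial defect between D_2k and 2 C_k, and its degree *)

Section Correction.

Local Open Scope ring_scope.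

(* [correction x k] is [D_(2(k+1)) - 2 C_(k+1)]: the index is shifted by one. *)
Fixpoint correction (R : comNzRingType) (x : R) (k : nat) : R :=
  if k is k'.+1 then
    (1 - x ^+ (2 * k)) * (1 - x ^+ (2 * k).+1) * correction x k'
    + 2 * x ^+ (2 * k).+1 * evens x 0 k
  else 1 + x.

(** The multiples of [distinct 1] in the two recurrences agree and cancel in the difference. For
    [k = 0] the difference is [2 x d + 1 - x - 2 x (d - 1) = 1 + x] with [d = distinct 1]. *)
Lemma Dseries_Cseries (R : comNzRingType) (x : R) N M k :
    x ^+ N = 0 -> (N <= M)%N -> (0 < N)%N ->
  Dseries x N M (2 * k.+1) = 2 * Cseries x N M k.+1 + correction x k.
Proof.
move=> xN0 leNM N_gt0; elim: k => [|k IHk].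
  by rewrite muln1 DseriesS // Fser1 // Gser1 //= expr1; ring.
rewrite (_ : 2 * k.+2 = (2 * k.+1).+2)%N; last by lia.
rewrite DseriesSS // IHk [Cseries _ _ _ k.+2]CseriesS //=; ring.
Qed.

Lemma rmorph_correction (R S : comNzRingType) (f : {rmorphism R -> S}) x k :
  f (correction x k) = correction (f x) k.
Proof.
elim: k => [|k IHk] /=; first by rewrite rmorphD rmorph1.
rewrite rmorphD !rmorphM !rmorphB !rmorphXn IHk !rmorph1 rmorph_nat.
congr (_ + _ * _); rewrite rmorph_prod; apply: eq_bigr => i _.
by rewrite rmorphB rmorph1 rmorphXn.
Qed.

Lemma size_mul_leS (p q : {poly int}) a b c :
  (size p <= a.+1 -> size q <= b.+1 -> a + b <= c -> size (p * q)%R <= c.+1)%N.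
Proof.
move=> pa qb abc; apply: leq_trans (size_polyMleq p q) _.
by move: (size p) (size q) pa qb => u v; lia.
Qed.

Lemma size_1subXn n : (size (1 - 'X^n : {poly int})%R <= n.+1)%N.
Proof.
by rewrite (leq_trans (size_polyD _ _)) // size_polyN size_polyXn size_poly1 geq_max ltnS leqnn.
Qed.

Lemma size_evens k : (size (evens ('X : {poly int}) 0 k) <= (k * k.+1).+1)%N.
Proof.
elim: k => [|k IHk]; first by rewrite /evens big_geq // size_poly1.
rewrite evensS; apply: size_mul_leS IHk (size_1subXn _) _; lia.
Qed.

(** With [K = k + 1] the degree bound is [K (2K - 1)]. Each step multiplies by a factor of degree
    [4K + 1], exactly the growth of this bound, while the added term stays below it. *)
Lemma size_correction k :
  (size (correction ('X : {poly int}) k) <= (k.+1 * (2 * k).+1).+1)%N.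
Proof.
elim: k => [|k IHk] /=; first by rewrite addrC -[1]polyC1 size_XaddC.
rewrite (leq_trans (size_polyD _ _)) // geq_max; apply/andP; split.
  apply: (@size_mul_leS _ _ ((2 * k.+1) + (2 * k.+1).+1) (k.+1 * (2 * k).+1)).
  - exact: size_mul_leS (size_1subXn _) (size_1subXn _) (leqnn _).
  - exact: IHk.
  lia.
rewrite -mulrA mulr_natl mulr2n (leq_trans (size_polyD _ _)) // maxnn.
apply: (@size_mul_leS _ _ (2 * k.+1).+1 (k.+1 * k.+2)).
- by rewrite size_polyXn.
- exact: size_evens.
lia.
Qed.

End Correction.

(** * Generating polynomials of multiplicity patterns *)

Lemma count_mparts a b (m : {ffun 'I_a -> 'I_b}) (p : pred nat) :
  count p (mparts m) = \sum_(i < a) p i * m i.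
Proof.
rewrite /mparts count_flatten -map_comp sumnE big_map big_enum /=.
by apply: eq_bigr => i _; rewrite count_nseq.
Qed.

Lemma count_mem_mparts a b (m : {ffun 'I_a -> 'I_b}) (i : 'I_a) :
  count_mem (i : nat) (mparts m) = m i.
Proof.
rewrite count_mparts (bigD1 i) //= eqxx mul1n big1 ?addn0 // => j.
by rewrite -val_eqE /= => /negPf ->.
Qed.

Lemma mparts_lt a b (m : {ffun 'I_a -> 'I_b}) : all (fun i => i < a) (mparts m).
Proof.
apply/allP => i /flattenP[_ /mapP[j _ ->]].
by rewrite mem_nseq => /andP[_ /eqP->].
Qed.

(** Some of the class conditions read the smallest parts off the front of the list and so depend on
    this order. *)
Lemma mparts_sorted a b (m : {ffun 'I_a -> 'I_b}) : sorted leq (mparts m).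
Proof.
rewrite sorted_pairwise; last exact: leq_trans.
have: pairwise leq (map val (enum 'I_a)).
  by rewrite val_enum_ord -sorted_pairwise ?iota_sorted //; apply: leq_trans.
rewrite /mparts; elim: (enum _) => //= i s IHs /andP[/allP le_is /IHs le_s].
rewrite pairwise_cat le_s andbT; apply/andP; split; last first.
  elim: (val (m i)) => //= c ->; rewrite andbT; apply/allP => j.
  by rewrite mem_nseq => /andP[_ /eqP->].
apply/allrelP => u v; rewrite mem_nseq => /andP[_ /eqP->].
case/flattenP=> _ /mapP[j js ->]; rewrite mem_nseq => /andP[_ /eqP->].
by apply: le_is; apply: map_f.
Qed.

Section GeneratingPolynomial.

Local Open Scope ring_scope.

(** A partition is weighted by the product over all [i < U], absent parts included, of [w i c] with
    [c] the multiplicity of [i]. Integer weights leave room for signs. *)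
Definition genpoly (R : comNzRingType) (x : R) (w : nat -> nat -> int) U M : R :=
  \prod_(0 <= i < U) \sum_(0 <= c < M) (w i c)%:~R * x ^+ (i * c).

(* Up to terms killed by [x^N = 0], enlarging the box of allowed parts and
   multiplicities only multiplies by the weights of the absent parts. *)
Lemma genpoly_box (R : comNzRingType) (x : R) w N a b U M :
    x ^+ N = 0 -> (0 < N)%N -> (N <= a <= U)%N -> (N <= b <= M)%N ->
    (forall c, (b <= c)%N -> w 0%N c = 0) ->
  genpoly x w U M = genpoly x w a b * \prod_(a <= i < U) (w i 0%N)%:~R.
Proof.
move=> xN0 N0 /andP[Na aU] /andP[Nb bM] w0.
have xN i : (N <= i)%N -> x ^+ i = 0.
  by move=> Ni; rewrite -(subnKC Ni) exprD xN0 mul0r.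
rewrite /genpoly (big_cat_nat (leq0n a) aU) //=; congr (_ * _).
  apply: eq_big_nat => i _; rewrite (big_cat_nat (leq0n b) bM) //= [X in _ + X]big_nat.
  rewrite [X in _ + X]big1 ?addr0 // => c /andP[bc _].
  (* The part 0 does not raise the exponent, so nilpotency says nothing about its multiplicity;
     there the hypothesis on [w 0] takes over. *)
  case: i => [|i]; first by rewrite w0 // mul0r.
  by rewrite xN ?mulr0 //; nia.
apply: eq_big_nat => i /andP[ai _].
rewrite big_ltn; last by lia.
rewrite muln0 mulr1 big_nat big1 ?addr0 // => c /andP[c0 _].
by rewrite xN ?mulr0 //; nia.
Qed.

Lemma coef_in_qpolyXn N (p : {poly int}) i : (i < N)%N ->
  (in_qpoly 'X^N p : {poly int})`_i = p`_i.
Proof.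
move=> iN; rewrite /= mk_monic_Xn prednK ?(leq_trans _ iN) //.
by rewrite {2}(Pdiv.RingMonic.rdivp_eq (monicXn _ N) p) coefD coefMXn iN add0r.
Qed.

Lemma in_qpolyXn_exp N : (0 < N)%N -> (in_qpoly ('X^N : {poly int}) 'X) ^+ N = 0.
Proof.
move=> N0; rewrite -rmorphXn; apply/(@npolyP int) => i; congr (_`_i).
by rewrite /= mk_monic_Xn prednK // Pdiv.RingMonic.rmodpp ?monicXn.
Qed.

Lemma rmorph_genpoly (R S : comNzRingType) (f : {rmorphism R -> S}) x w U M :
  f (genpoly x w U M) = genpoly (f x) w U M.
Proof.
rewrite rmorph_prod; apply: eq_bigr => i _; rewrite rmorph_sum.
by apply: eq_bigr => c _; rewrite rmorphM rmorph_int rmorphXn.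
Qed.

(** Choosing one summand in every factor amounts to choosing a multiplicity function. *)
Lemma genpolyE (R : comNzRingType) (x : R) w a b :
  genpoly x w a b = \sum_(m : {ffun 'I_a -> 'I_b})
    (\prod_(i < a) w i (m i))%:~R * x ^+ (\sum_(i < a) i * m i)%N.
Proof.
rewrite /genpoly big_mkord.
transitivity (\prod_(i < a) \sum_(c < b) (w i c)%:~R * x ^+ (i * c)).
  by apply: eq_bigr => i _; rewrite big_mkord.
rewrite bigA_distr_bigA /=; apply: eq_bigr => m _.
by rewrite big_split /= -expr_sum rmorph_prod.
Qed.

(** The coefficient of [X^n] is visible modulo [X^(n+1)], and there the box [a] by [b] of the
    encoding can be exchanged for the common box [U] by [M]; parts from [a] to [U] are absent and
    contribute [w i 0]. *)
Lemma sum_mparts_genpoly n a b U M (w : nat -> nat -> int) :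
    (n < a <= U)%N -> (n < b <= M)%N -> (forall c, (b <= c)%N -> w 0%N c = 0) ->
  \sum_(m : {ffun 'I_a -> 'I_b} | (\sum_(i < a) i * m i)%N == n)
      \prod_(0 <= i < U) w i (count_mem i (mparts m))
  = (genpoly 'X w U M)`_n.
Proof.
move=> anU bnM w0.
rewrite -(@coef_in_qpolyXn n.+1) // rmorph_genpoly.
rewrite (@genpoly_box _ _ w n.+1 a b) ?in_qpolyXn_exp //.
rewrite -rmorph_genpoly.
have -> : \prod_(a <= i < U) (w i 0%N)%:~R =
    in_qpoly ('X^(n.+1) : {poly int}) (\prod_(a <= i < U) w i 0%N)%:~R.
  by rewrite (rmorph_int (in_qpoly ('X^(n.+1) : {poly int}))) rmorph_prod.
rewrite -rmorphM coef_in_qpolyXn // mulrzr coefMrz -mulrzr intz.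
rewrite genpolyE coef_sum mulr_suml [LHS]big_mkcond /=.
apply: eq_bigr => m _; have /andP[na aU] := anU.
rewrite (big_cat_nat (leq0n a) aU) //= big_mkord.
have -> : \prod_(i < a) w i (count_mem (i : nat) (mparts m)) = \prod_(i < a) w i (m i).
  by apply: eq_bigr => i _; rewrite count_mem_mparts.
have -> : \prod_(a <= i < U) w i (count_mem i (mparts m)) = \prod_(a <= i < U) w i 0%N.
  apply: eq_big_nat => i /andP[ai _]; congr (w _ _).
  by apply/count_memPn; apply/negP => /(allP (mparts_lt m)); rewrite ltnNge ai.
rewrite mulrzl coefMrz coefXn -mulrzl intz eq_sym; case: eqP => _.
  by rewrite mulr1.
by rewrite mulr0 mul0r.
Qed.

(** A class condition is seldom a product over the parts, but becomes one once a parameter [t], such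
    as the smallest part, is fixed; hence the sum over [t]. *)
Lemma sum_mparts_sum_genpoly n a b U M (T : nat) (w : nat -> nat -> nat -> int) phi :
    (n < a <= U)%N -> (n < b <= M)%N ->
    (forall t c, (b <= c)%N -> w t 0%N c = 0) ->
    (forall s, sorted leq s -> all (fun i => i < a)%N s ->
       phi s = \sum_(0 <= t < T) \prod_(0 <= i < U) w t i (count_mem i s)) ->
  \sum_(m : {ffun 'I_a -> 'I_b} | (\sum_(i < a) i * m i)%N == n) phi (mparts m)
  = (\sum_(0 <= t < T) genpoly 'X (w t) U M)`_n.
Proof.
move=> anU bnM w0 phiE; rewrite coef_sum.
under [RHS]eq_bigr => t _.
  rewrite -(sum_mparts_genpoly anU bnM); last exact: w0.
  over.
rewrite exchange_big /=; apply: eq_bigr => m _.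
by rewrite phiE ?mparts_sorted ?mparts_lt.
Qed.

Lemma pcountE n P :
  (pcount n P)%:R = \sum_(m : {ffun 'I_n.+1 -> 'I_n.+1} | (\sum_(i < n.+1) i * m i)%N == n)
    ((count_mem 0%N (mparts m) == 0%N) && P (mparts m))%:R :> int.
Proof.
rewrite /pcount -sum1dep_card natr_sum big_mkcond [RHS]big_mkcond /=.
apply: eq_bigr => m _; rewrite (count_mem_mparts m ord0) /=.
by do 2!case: eqP => _; case: (P _).
Qed.

Lemma pcount0E n b P :
  (pcount0 n b P)%:R =
  \sum_(m : {ffun 'I_n.+1 -> 'I_(n + b).+1} | (\sum_(i < n.+1) i * m i)%N == n)
    (P (mparts m))%:R :> int.
Proof.
rewrite /pcount0 -sum1dep_card natr_sum big_mkcond [RHS]big_mkcond /=.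
by apply: eq_bigr => m _; case: eqP => // _; case: (P _).
Qed.

End GeneratingPolynomial.

(* [a] is the smallest part, with multiplicity [e].  The cases [a = 1] with
   [e = 0] and [e = j - 1] also describe the classes counted by P_1 and P'_(j-1). *)
Definition D_mults (a e i c : nat) : bool :=
  if i < a then c == 0 else if i == a then c == e else c <= 1.

(* [e = 0] and [e = j - 1] give the nonempty partitions counted by P_2 and those
   counted by P''_(j-1). *)
Definition A_mults (a e i c : nat) : bool :=
  if i < a then c == 0 else if i == a then c == 1
  else if i == a.+1 then c == e else c <= 1.

(* The largest odd part is [2l + 1], so [l] is one less than in the paper. *)
Definition B_mults (k l i c : nat) : bool :=
  if odd i then
    if i < (2 * l).+1 then true else if i == (2 * l).+1 then 0 < c else c == 0
  else if 2 * l + 4 <= i <= 2 * l + 2 * k then c <= 1 else c == 0.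

Definition C_mults (k l i c : nat) : bool :=
  if i <= 2 * l then
    if i == 0 then c == 0 else if i <= l then c <= 1
    else if i < 2 * l then true else 0 < c
  else if ~~ odd i && (i <= 2 * l + 2 * k - 2) then c <= 1 else c == 0.

(** * Weights of the classes and the products they generate *)

Section Weights.

Local Open Scope ring_scope.

Definition D_weight (a e i c : nat) : int := (D_mults a e i c)%:R.

Definition A_weight (a e i c : nat) : int := (A_mults a e i c)%:R.

(** The sign turns a difference of counts by parity into factors [1 - x^i]. *)
Definition signed_le1 (c : nat) : int := (c <= 1)%N%:R * (-1) ^+ c.

Definition B_weight (k l i c : nat) : int :=
  if odd i then
    (if (i < (2 * l).+1)%N then true
     else if i == (2 * l).+1 then (0 < c)%N else c == 0%N)%:R
  else if (2 * l + 4 <= i <= 2 * l + 2 * k)%N then signed_le1 c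
  else (c == 0%N)%:R.

Definition C_weight (k l i c : nat) : int :=
  if (i <= 2 * l)%N then
    (if i == 0%N then c == 0%N else if (i <= l)%N then (c <= 1)%N
     else if (i < 2 * l)%N then true else (0 < c)%N)%:R
  else if ~~ odd i && (i <= 2 * l + 2 * k - 2)%N then signed_le1 c
  else (c == 0%N)%:R.

Lemma prod_nat_pairs (R : comNzRingType) a b (F : nat -> R) : (a <= b)%N ->
  \prod_(2 * a <= i < 2 * b) F i
  = \prod_(a <= i < b) F (2 * i)%N * \prod_(a <= i < b) F (2 * i).+1.
Proof.
move=> ab; rewrite -(subnKC ab); elim: (b - a)%N => [|d IHd].
  by rewrite addn0 !big_geq // mulr1.
rewrite addnS mulnS !add2n !big_nat_recr ?IHd //=; try lia.
ring.
Qed.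

Variables (R : comNzRingType) (x : R) (N M : nat).
Hypotheses (xN0 : x ^+ N = 0) (leNM : (N <= M)%N) (N_gt1 : (1 < N)%N).

Let factor (v : nat -> int) i := \sum_(0 <= c < M) (v c)%:~R * x ^+ (i * c).

Let M_gt1 : (1 < M)%N. Proof. exact: leq_trans leNM. Qed.
Let N_gt0 : (0 < N)%N. Proof. exact: ltnW. Qed.

Lemma factor_eq e i : (e < M)%N ->
  factor (fun c => (c == e)%:R) i = x ^+ (i * e).
Proof.
move=> eM; rewrite /factor big_mkord (bigD1 (Ordinal eM)) //= eqxx mul1r.
rewrite big1 ?addr0 // => c; rewrite -val_eqE /= => /negPf->.
by rewrite mul0r.
Qed.

Lemma factor_small (v : nat -> int) i : (forall c, (1 < c)%N -> v c = 0) ->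
  factor v i = (v 0%N)%:~R + (v 1%N)%:~R * x ^+ i.
Proof.
move=> v0; rewrite /factor big_ltn ?(ltnW M_gt1) // big_ltn // muln0 mulr1 muln1.
by rewrite big_nat big1 ?addr0 // => c /andP[c1 _]; rewrite v0 // mul0r.
Qed.

Lemma factor_le1 i : factor (fun c => (c <= 1)%N%:R) i = 1 + x ^+ i.
Proof. by rewrite factor_small ?mul1r // => c; rewrite ltnNge => /negPf->. Qed.

Lemma factor_signed i : factor signed_le1 i = 1 - x ^+ i.
Proof.
rewrite factor_small /signed_le1 => [|c].
  by rewrite !mul1r rmorphN1 mulN1r.
by rewrite ltnNge => /negPf->; rewrite mul0r.
Qed.

Lemma factor_all i : factor (fun=> 1) i = geo x M i.
Proof. by rewrite /factor big_mkord; apply: eq_bigr => c _; rewrite mul1r. Qed.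

Lemma factor_pos i : (0 < i)%N -> factor (fun c => (0 < c)%N%:R) i = x ^+ i * geo x M i.
Proof.
move=> i0; rewrite -[in RHS]factor_all /factor.
rewrite -(prednK (ltnW M_gt1)) [LHS]big_nat_recl // mul0r add0r.
rewrite [in RHS]big_nat_recr //= mulrDr mul1r -exprD -mulnS prednK ?(ltnW M_gt1) //.
rewrite (@exprN0 _ _ _ xN0 (i * M)); last by nia.
rewrite addr0 mulr_sumr; apply: eq_bigr => c _.
by rewrite !mul1r -exprD mulnS.
Qed.

Lemma genpoly_factor w U : genpoly x w U M = \prod_(0 <= i < U) factor (w i) i.
Proof. by []. Qed.

Lemma eq_factor v v' i : v =1 v' -> factor v i = factor v' i.
Proof. by move=> vv'; apply: eq_bigr => c _; rewrite vv'. Qed.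

Lemma factor_eq0 v i : (forall c, v c = (c == 0%N)%:R) -> factor v i = 1.
Proof. by move/eq_factor->; rewrite factor_eq ?muln0 // ltnW. Qed.

(** Parts run up to [2 * M] so that even and odd ones are both indexed by [i < M]; the factors from
    [M] on are 1. *)
Lemma distinct_widen a : \prod_(a <= i < 2 * M) (1 + x ^+ i) = distinct x M a.
Proof.
have x1 i : (M <= i)%N -> 1 + x ^+ i = 1.
  by move=> Mi; rewrite (exprN0 xN0) ?addr0 // (leq_trans leNM).
have [aM|Ma] := leqP a M.
  rewrite (@big_cat_nat _ _ _ M) //=; last by lia.
  by rewrite [X in _ * X]big_nat [X in _ * X]big1 ?mulr1 // => i /andP[/x1].
rewrite /distinct [RHS]big_geq 1?ltnW // big_nat big1 // => i /andP[ai _].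
by rewrite x1 // (leq_trans _ ai) // ltnW.
Qed.

Lemma genpoly_D_weight a e : (a < M)%N -> (e < M)%N ->
  genpoly x (D_weight a e) (2 * M) M = x ^+ (a * e) * distinct x M a.+1.
Proof.
move=> aM eM; rewrite genpoly_factor (@big_cat_nat _ _ _ a) //=; last by lia.
rewrite (@big_ltn _ _ _ a); last by lia.
rewrite big_nat big1 => [|i /andP[_ ia]]; last first.
  by rewrite /D_weight /D_mults ia factor_eq ?muln0 // ltnW.
rewrite mul1r -distinct_widen /D_weight /D_mults ltnn eqxx factor_eq //; congr (_ * _).
apply: eq_big_nat => i /andP[ai _]; rewrite ltnNge (ltnW ai) gtn_eqF //=.
exact: factor_le1.
Qed.

Lemma genpoly_A_weight a e : (a.+1 < M)%N -> (e < M)%N ->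
  genpoly x (A_weight a e) (2 * M) M = x ^+ (a + a.+1 * e) * distinct x M a.+2.
Proof.
move=> aM eM; rewrite genpoly_factor (@big_cat_nat _ _ _ a) //=; last by lia.
rewrite (@big_ltn _ _ _ a); last by lia.
rewrite (@big_ltn _ _ _ a.+1); last by lia.
rewrite big_nat big1 => [|i /andP[_ ia]]; last first.
  by rewrite /A_weight /A_mults ia factor_eq ?muln0 // ltnW.
rewrite mul1r -distinct_widen /A_weight /A_mults ltnn eqxx factor_eq // muln1 mulrA.
rewrite ltnNge leqnSn gtn_eqF // eqxx /= factor_eq // exprD; congr (_ * _).
apply: eq_big_nat => i /andP[ai _].
rewrite ltnNge (ltnW (ltnW ai)) !gtn_eqF ?(ltnW ai) //=.
exact: factor_le1.
Qed.

Lemma genpoly_empty U : genpoly x (fun _ c => (c == 0%N)%:R) U M = 1.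
Proof.
rewrite genpoly_factor big1 // => i _.
by rewrite factor_eq ?muln0 // ltnW.
Qed.

Lemma prod_nat_support a b c (F G : nat -> R) : (a <= b)%N -> (b <= c)%N ->
  (forall i, (a <= i < b)%N -> F i = G i) -> (forall i, (b <= i)%N -> F i = 1) ->
  \prod_(a <= i < c) F i = \prod_(a <= i < b) G i.
Proof.
move=> ab bc FG F1; rewrite (big_cat_nat ab bc) /= (eq_big_nat _ _ FG).
by rewrite [X in _ * X]big_nat [X in _ * X]big1 ?mulr1 // => i /andP[/F1].
Qed.

(** The odd parts up to [2l+1] give [odds l.+1], the forced part [2l+1] gives the power of [x], and
    the signed even parts [2l+4, ..., 2l+2k] give [evens l.+1 k.-1]. *)
Lemma genpoly_B_weight k l : (0 < k)%N -> (l + k < M)%N ->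
  genpoly x (B_weight k l) (2 * M) M
  = x ^+ (2 * l).+1 * (odds x M l.+1 * evens x l.+1 k.-1).
Proof.
move=> k0 lkM; rewrite genpoly_factor -[X in index_iota X _](muln0 2).
rewrite prod_nat_pairs //.
rewrite (@big_cat_nat _ _ _ l.+2) //=; last by lia.
rewrite big_nat big1 => [|i /andP[_ il]]; last first.
  apply: factor_eq0 => c.
  by rewrite /B_weight oddM /= ifF //; lia.
rewrite mul1r.
rewrite (@prod_nat_support l.+2 (l.+2 + k.-1) M _ (fun i => 1 - x ^+ (2 * i))); try lia; last first.
- move=> i il.
  apply: factor_eq0 => c.
  by rewrite /B_weight oddM /= ifF //; lia.
- move=> i il; rewrite -factor_signed; apply: eq_factor => c.
  by rewrite /B_weight oddM /= ifT //; lia.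
rewrite mulrC mulrA; congr (_ * _).
rewrite (@prod_nat_support 0 l.+1 M _ (fun i =>
  (if i == l then x ^+ (2 * l).+1 else 1) * geo x M (2 * i).+1)); try lia; last first.
- move=> i il.
  apply: factor_eq0 => c.
  by rewrite /B_weight /= oddM /= !ifF //; lia.
- move=> i /andP[_]; rewrite ltnS leq_eqVlt => /orP[/eqP->|il].
    rewrite eqxx -factor_pos //; apply: eq_factor => c.
    by rewrite /B_weight /= oddM /= ltnn eqxx.
  rewrite ltn_eqF // mul1r -factor_all; apply: eq_factor => c.
  by rewrite /B_weight /= oddM /= ifT //; lia.
rewrite big_mkord big_split /= /odds; congr (_ * _).
rewrite big_ord_recr /= eqxx big1 ?mul1r // => i _.
by rewrite ltn_eqF.
Qed.

(** Distinct parts up to [l] give [(-q)_l] and free parts from [l+1] to [2l] give [1 / (q^(l+1))_l];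
    [oddsE] fuses them into [odds l], which is how this class meets the one with odd parts. *)
Lemma genpoly_C_weight k l : (0 < k)%N -> (0 < l)%N -> (l + k < M)%N ->
  genpoly x (C_weight k l) (2 * M) M = x ^+ (2 * l) * (odds x M l * evens x l k.-1).
Proof.
(* The cut is at [2l+2], not [2l+1], to leave an even starting point for the pairing; the factor at
   [2l+1] is 1. *)
move=> k0 l0 lkM; rewrite genpoly_factor (@big_cat_nat _ _ _ (2 * l.+1)) //=; last by lia.
rewrite prod_nat_pairs; last by lia.
rewrite (@prod_nat_support l.+1 (l.+1 + k.-1) M _ (fun i => 1 - x ^+ (2 * i))); try lia; last first.
- move=> i il.
  apply: factor_eq0 => c.
  by rewrite /C_weight oddM /= !ifF //; lia.
- move=> i il; rewrite -factor_signed; apply: eq_factor => c.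
  by rewrite /C_weight oddM /= ifF ?ifT //; lia.
rewrite [X in _ * (_ * X) = _]big_nat.
rewrite [X in _ * (_ * X) = _]big1 ?mulr1 => [|i /andP[il _]]; last first.
  apply: factor_eq0 => c.
  by rewrite /C_weight /= oddM /= ifF //; lia.
rewrite mulrA -/(evens x l k.-1); congr (_ * _).
rewrite (oddsE xN0) // mulnS add2n big_nat_recr //= (@big_cat_nat _ _ _ l.+1) //=; last by lia.
rewrite (@big_ltn _ _ _ 0%N) //.
rewrite [X in _ * X * _ = _](@big_nat_recr _ _ _ (2 * l)) /=; last by lia.
have -> : factor (C_weight k l 0) 0 = 1.
  exact: factor_eq0.
have -> : factor (C_weight k l (2 * l).+1) (2 * l).+1 = 1.
  apply: factor_eq0 => c.
  by rewrite /C_weight ltnn /= oddM.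
have -> : factor (C_weight k l (2 * l)) (2 * l) = x ^+ (2 * l) * geo x M (2 * l).
  rewrite -factor_pos; last by lia.
  by apply: eq_factor => c; rewrite /C_weight leqnn !ifF //; lia.
rewrite [X in _ = _ * (_ * X)](@big_nat_recr _ _ _ (2 * l)) /=; last by lia.
rewrite (eq_big_nat _ _ (F2 := fun i => 1 + x ^+ i)) => [|i il]; last first.
  rewrite -factor_le1; apply: eq_factor => c.
  have [e1 e2 e3] : [/\ (i <= 2 * l)%N, (i == 0%N) = false & (i <= l)%N] by split; lia.
  by rewrite /C_weight e1 e2 e3.
rewrite [X in _ * (X * _) * _](eq_big_nat _ _ (F2 := fun i => geo x M i)) => [|i il]; last first.
  rewrite -factor_all; apply: eq_factor => c.
  have [e1 e2 e3 e4] : [/\ (i <= 2 * l)%N, (i == 0%N) = false, (i <= l)%N = false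
    & (i < 2 * l)%N] by split; lia.
  by rewrite /C_weight e1 e2 e3 e4.
ring.
Qed.

End Weights.

(** * The conditions of the partition classes as multiplicity patterns *)

Section Conditions.

Implicit Types (s : seq nat) (p : pred nat).

Lemma uniq_filterP s p :
  reflect (forall i, p i -> count_mem i s <= 1) (uniq [seq y <- s | p y]).
Proof.
apply: (iffP idP) => [us i pi|].
  have -> : count_mem i s = count_mem i [seq y <- s | p y].
    by rewrite count_filter; apply: eq_count => y /=; case: eqP => //= ->.
  by rewrite (count_uniq_mem _ us) leq_b1.
elim: s => //= x s IHs cs.
have {}IHs : uniq [seq y <- s | p y].
  by apply: IHs => i /cs; apply: leq_trans; apply: leq_addl.
case: ifP => //= /cs; rewrite eqxx IHs andbT mem_filter => cx.
by apply/negP => /andP[_]; rewrite -has_pred1 has_count lt0n; case: (count _ _) cx.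
Qed.

Lemma uniqP_count s : reflect (forall i, count_mem i s <= 1) (uniq s).
Proof.
rewrite -[s in uniq s]filter_predT.
by apply: (iffP (uniq_filterP s predT)) => cs i; [apply: cs | move=> _; apply: cs].
Qed.

Lemma sorted_count_lt x s i : sorted leq (x :: s) -> i < x -> count_mem i (x :: s) = 0.
Proof.
move=> /(order_path_min leq_trans)/allP xs ix; apply/count_memPn.
by rewrite inE negb_or ltn_eqF //=; apply/negP => /xs; rewrite leqNgt ix.
Qed.

Lemma mem_count i s : (i \in s) = (0 < count_mem i s).
Proof. by rewrite -has_pred1 has_count. Qed.

Lemma count_ge_lt U s i : all (fun y => y < U) s -> U <= i -> count_mem i s = 0.
Proof.
by move=> /allP sU Ui; apply/count_memPn; apply/negP => /sU; rewrite ltnNge Ui.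
Qed.

Definition obeys U (b : nat -> nat -> bool) s :=
  all (fun i => b i (count_mem i s)) (iota 0 U).

Lemma obeysP U (b : nat -> nat -> bool) s :
  (forall i, U <= i -> b i 0) -> all (fun y => y < U) s ->
  reflect (forall i, b i (count_mem i s)) (obeys U b s).
Proof.
move=> b0 sU; apply: (iffP allP) => [bs i|bs i _] //.
have [iU|Ui] := ltnP i U; first by apply: bs; rewrite mem_iota.
by rewrite (count_ge_lt sU Ui) b0.
Qed.

Lemma count_sum U s p : all (fun y => y < U) s ->
  count p s = \sum_(0 <= i < U) p i * count_mem i s.
Proof.
elim: s => [_|x s IHs /= /andP[xU /IHs->]].
  by rewrite big1 // => i _; rewrite muln0.
under [RHS]eq_bigr do rewrite mulnDr.
rewrite big_split /=; congr (_ + _).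
rewrite big_mkord (bigD1 (Ordinal xU)) //= eqxx muln1 big1 ?addn0 // => i.
by rewrite -val_eqE /= eq_sym => /negPf->; rewrite muln0.
Qed.

Lemma prod_obeys U (b : nat -> nat -> bool) p s : all (fun y => y < U) s ->
  (\prod_(0 <= i < U) ((b i (count_mem i s))%:R * (-1) ^+ (p i * count_mem i s)%N)
   = (obeys U b s)%:R * (-1) ^+ count p s :> int)%R.
Proof.
move=> sU; rewrite big_split /= prodrXr -count_sum //; congr (_ * _)%R.
rewrite /obeys /index_iota subn0; elim: (iota 0 U) => [|i r IHr]; first by rewrite big_nil.
by rewrite big_cons IHr -natrM mulnb.
Qed.

(** Turns a condition with a unique witness, such as the smallest or the largest odd part, into a
    sum over the possible witnesses. *)
Lemma sum_unique T (P : pred nat) (b : bool) :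
  (forall t u, t < T -> u < T -> P t -> P u -> t = u) -> (b <-> exists2 t, t < T & P t) ->
  (b%:R = \sum_(0 <= t < T) (P t)%:R :> int)%R.
Proof.
move=> Pu [bP Pb]; have [/bP[t tT Pt]|/negP nb] := boolP b.
  rewrite big_mkord (bigD1 (Ordinal tT)) //= Pt big1 ?addr0 // => u.
  rewrite -val_eqE /= => ut; case Pu': (P u) => //.
  by rewrite (Pu _ _ (ltn_ord u) tT Pu' Pt) eqxx in ut.
rewrite big_nat big1 // => t tT; case Pt: (P t) => //.
by case: nb; apply: Pb; exists t.
Qed.

Lemma obeys_D_multsP U t e s : t < U -> all (fun y => y < U) s ->
  reflect [/\ forall i, i < t -> count_mem i s = 0, count_mem t s = e
    & forall i, t < i -> count_mem i s <= 1] (obeys U (D_mults t e) s).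
Proof.
move=> tU sU; apply: (iffP (obeysP _ sU)) => [i Ui|bs|[lts ts gts] i].
- by rewrite /D_mults ifF ?ifF //; lia.
- split=> [i it||i ti]; first by have := bs i; rewrite /D_mults it => /eqP.
    by have := bs t; rewrite /D_mults ltnn eqxx => /eqP.
  by have := bs i; rewrite /D_mults ltnNge ltnW //= gtn_eqF.
- by rewrite /D_mults; case: ltngtP => [/lts->|/gts|->] //; rewrite ts.
Qed.

Lemma obeys_A_multsP U t e s : t.+1 < U -> all (fun y => y < U) s ->
  reflect [/\ forall i, i < t -> count_mem i s = 0, count_mem t s = 1,
    count_mem t.+1 s = e & forall i, t.+1 < i -> count_mem i s <= 1]
    (obeys U (A_mults t e) s).
Proof.
move=> tU sU; apply: (iffP (obeysP _ sU)) => [i Ui|bs|[lts ts t1s gts] i].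
- by rewrite /A_mults !ifF //; lia.
- split=> [i it|||i ti]; first by have := bs i; rewrite /A_mults it => /eqP.
  + by have := bs t; rewrite /A_mults ltnn eqxx => /eqP.
  + by have := bs t.+1; rewrite /A_mults ltnNge leqnSn /= gtn_eqF // eqxx => /eqP.
  + have [e1 e2 e3] : [/\ (i < t) = false, (i == t) = false & (i == t.+1) = false] by split; lia.
    by have := bs i; rewrite /A_mults e1 e2 e3.
- rewrite /A_mults; case: (ltngtP i t) => [/lts->|ti|->] //; last by rewrite ts.
  by case: eqP => [->|/eqP it]; [rewrite t1s | apply: gts; lia].
Qed.

Lemma obeys_nil U s : all (fun y => y < U) s -> obeys U (fun _ c => c == 0) s = (s == [::]).
Proof.
move=> sU; apply/(obeysP _ sU)/eqP => [//|s0|-> //].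
case: s s0 {sU} => // x s /(_ x) /=; by rewrite eqxx.
Qed.

Lemma sorted_head_count t s : sorted leq s ->
    (forall i, i < t -> count_mem i s = 0) -> 0 < count_mem t s ->
  exists r, s = t :: r.
Proof.
case: s => // x r srt t0 tr; exists r; congr (_ :: _).
apply/eqP; rewrite eqn_leq; apply/andP; split; rewrite leqNgt; apply/negP.
  by move/(sorted_count_lt srt) => e; rewrite e in tr.
by move/t0 => /=; rewrite eqxx.
Qed.

(** * Classes sorted out by their smallest part *)

Section Sorted.
Variables (U T : nat) (s : seq nat).
Hypotheses (s_sorted : sorted leq s) (sT : all (fun y => y < T) s) (TU : T < U).

Let sU : all (fun y => y < U) s.
Proof. by apply: sub_all sT => y yT; apply: ltn_trans TU. Qed.

(** The parameter is the smallest part. Two values [t < u] exclude each other: the pattern of [u]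
    forbids [t], that of [t] has it [j > 0] times. *)
Lemma D_condE j : 0 < j ->
  ((D_cond j s)%:R = \sum_(0 <= t < T) (obeys U (D_mults t j) s)%:R :> int)%R.
Proof.
move=> j_gt0; apply: sum_unique => [t u tT uT|].
  move=> /obeys_D_multsP-/(_ (ltn_trans tT TU) sU) [t0 tj _].
  move=> /obeys_D_multsP-/(_ (ltn_trans uT TU) sU) [u0 uj _].
  by case: (ltngtP t u) => [/u0|/t0|//]; lia.
split=> [|[t tT /obeys_D_multsP-/(_ (ltn_trans tT TU) sU) [t0 tj t1]]].
  case: s s_sorted sT sU => // x r srt rT rU /andP[/eqP xj /uniq_filterP ur].
  have xT : x < T by case/andP: rT.
  exists x => //; apply/obeys_D_multsP => //; first exact: ltn_trans TU.
  by split=> // i ix; apply: sorted_count_lt.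
have [|r sE] := sorted_head_count s_sorted t0; first by rewrite tj.
rewrite sE /D_cond -sE tj eqxx /=.
by apply/uniq_filterP.
Qed.

Lemma P1_condE : 1 < U ->
  (count_mem 0 s == 0) && P1_cond s = obeys U (D_mults 1 0) s.
Proof.
move=> U1; apply/idP/(obeys_D_multsP _ U1 sU) => [/and3P[/eqP s0 /uniqP_count us /count_memPn s1]|].
  by split=> // -[].
case=> s0 s1 us; rewrite /P1_cond s0 //= ; apply/andP; split.
  by apply/uniqP_count => -[|[|i]]; [rewrite s0 | rewrite s1 | apply: us].
by apply/count_memPn.
Qed.

Lemma P'_condE j : 1 < U ->
  (count_mem 0 s == 0) && P'_cond j s = obeys U (D_mults 1 (j - 1)) s.
Proof.
move=> U1; apply/idP/(obeys_D_multsP _ U1 sU) => [/and3P[/eqP s0 /eqP s1 /uniq_filterP us]|].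
  by split=> // -[].
case=> s0 s1 us; rewrite /P'_cond s0 //= s1 eqxx.
exact/uniq_filterP.
Qed.

Lemma obeys_A_mults_unique e t u : t.+1 < U -> u.+1 < U ->
  obeys U (A_mults t e) s -> obeys U (A_mults u e) s -> t = u.
Proof.
move=> tU uU /(obeys_A_multsP _ tU sU)[t0 t1 _ _] /(obeys_A_multsP _ uU sU)[u0 u1 _ _].
by case: (ltngtP t u) => [/u0|/t0|//]; lia.
Qed.

(** The empty partition has no smallest part and gets its own term. Otherwise the smallest part is
    [t.+1], positive and less than [T], and the gap condition says that [t.+2] is absent. *)
Lemma P2_condE :
  (((count_mem 0 s == 0)%N && P2_cond s)%:R =
   (obeys U (fun _ c => c == 0%N) s)%:R
   + \sum_(0 <= t < T.-1) (obeys U (A_mults t.+1 0%N) s)%:R :> int)%R.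
Proof.
rewrite obeys_nil //; have [s0|s_neq0] := eqVneq s [::].
  rewrite big_nat big1 => [|t tT]; first by rewrite s0.
  case: obeys_A_multsP => //; first by lia.
  by case=> _; rewrite s0.
rewrite add0r; apply: sum_unique => [t u tT uT Pt Pu|].
  by apply: succn_inj; apply: obeys_A_mults_unique Pt Pu; lia.
split=> [/andP[/eqP z0]|[t tT]].
  case: s s_sorted sT sU z0 s_neq0 => // x r srt rT rU z0 _ /andP[/uniqP_count us gap].
  have x0 : 0 < x by rewrite lt0n; apply: contra_eq_neq z0 => /= ->.
  have xT : x < T by case/andP: rT.
  have cx : count_mem x (x :: r) = 1.
    by have := us x; rewrite /= eqxx; case: (count _ _).
  exists x.-1; first by lia.
  apply/obeys_A_multsP; rewrite ?prednK //; first by lia.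
  split=> // [i ix|]; first exact: sorted_count_lt.
  apply/count_memPn; rewrite inE negb_or gtn_eqF //=.
  case: r srt gap {rT rU z0 us cx} => // y r /= /andP[_ yr] gap.
  rewrite inE negb_or ltn_eqF; last by lia.
  by apply/negP => /(allP (order_path_min leq_trans yr)); lia.
move=> /obeys_A_multsP-/(_ _ sU) []; first by lia.
move=> lt1 t1 t2 us; rewrite lt1 //=.
have [|r sE] := sorted_head_count s_sorted lt1; first by rewrite t1.
have uniq_s : uniq s.
  apply/uniqP_count => i; case: (ltngtP i t.+1) => [/lt1->|ti|->]; rewrite ?t1 //.
  by case: (eqVneq i t.+2) => [->|it]; rewrite ?t2 //; apply: us; lia.
rewrite /P2_cond uniq_s /=; case: s sE s_sorted t2 uniq_s => // _ [//|y r'] [-> _].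
move=> /= /andP[ty _] /eqP; rewrite addn2.
rewrite !addn_eq0 !eqb0 => /and3P[_ y2 _] /andP[].
by rewrite inE negb_or => /andP[y1 _] _; lia.
Qed.

Lemma P''_condE j :
  (((count_mem 0 s == 0)%N && P''_cond j s)%:R =
   \sum_(0 <= t < T.-1) (obeys U (A_mults t.+1 (j - 1)%N) s)%:R :> int)%R.
Proof.
apply: sum_unique => [t u tT uT Pt Pu|].
  by apply: succn_inj; apply: obeys_A_mults_unique Pt Pu; lia.
split=> [/andP[/eqP z0]|[t tT]].
  case: s s_sorted sT sU z0 => // x r srt rT rU z0.
  case/andP=> /andP[/eqP rE /uniqP_count us /allP gt_d].
  have x0 : 0 < x by rewrite lt0n; apply: contra_eq_neq z0 => /= ->.
  have xT : x < T by case/andP: rT.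
  have cE i : count_mem i (x :: r)
      = (x == i) + ((x.+1 == i) * (j - 1) + count_mem i (drop (j - 1) r)).
    by rewrite /= -{1}(cat_take_drop (j - 1) r) count_cat rE count_nseq.
  have d0 i : i <= x.+1 -> count_mem i (drop (j - 1) r) = 0.
    by move=> ix; apply/count_memPn/negP => /gt_d; lia.
  exists x.-1; first by lia.
  apply/obeys_A_multsP; rewrite ?prednK //; first by lia.
  split=> [i ix|||i ix].
  - exact: sorted_count_lt.
  - by rewrite cE eqxx d0 // gtn_eqF.
  - by rewrite cE ltn_eqF // eqxx mul1n d0 // addn0.
  - by rewrite cE !ltn_eqF ?us // ltnW.
move=> /obeys_A_multsP-/(_ _ sU) []; first by lia.
move=> lt1 t1 t2 us; rewrite lt1 //=.
have [|r sE] := sorted_head_count s_sorted lt1; first by rewrite t1.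
(* A sorted list is determined by its multiplicities, so [r] is the block of parts [t.+2] followed
   by the larger ones; [take] and [drop] then cut it at this point. *)
have rE : r = nseq (j - 1) t.+2 ++ [seq y <- r | t.+2 < y].
  have sr : sorted leq r.
    by apply: subseq_sorted s_sorted; [exact: leq_trans | rewrite sE subseq_cons].
  apply: (sorted_eq leq_trans anti_leq) => //.
    rewrite sorted_pairwise; last exact: leq_trans.
    rewrite pairwise_cat -[pairwise _ (filter _ _)]sorted_pairwise; last exact: leq_trans.
    rewrite sorted_filter //; last exact: leq_trans.
    rewrite andbT; apply/andP; split.
      apply/allrelP => u v; rewrite mem_nseq mem_filter => /andP[_ /eqP->] /andP[uv _].
      exact: ltnW.
    elim: (j - 1) => //= c ->; rewrite andbT; apply/allP => v.
    by rewrite mem_nseq => /andP[_ /eqP->].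
  apply/allP => y _ /=; rewrite count_cat count_nseq count_filter /=.
  have cr : count_mem y s = (t.+1 == y) + count_mem y r by rewrite sE.
  have [ty|yt] := ltnP t.+2 y.
    rewrite (ltn_eqF ty) mul0n add0n; apply/eqP; apply: eq_count => z /=.
    by case: eqP => //= ->; rewrite ty.
  rewrite [X in _ + X](_ : _ = 0) ?addn0; last first.
    rewrite (eq_count (a2 := pred0)) ?count_pred0 // => z /=.
    by case: eqP => //= ->; rewrite ltnNge yt.
  case: (ltngtP y t.+1) cr => [yt1|ty1|->].
  - by rewrite lt1 // => /esym/eqP; rewrite addn_eq0 (gtn_eqF (leqW yt1)) mul0n => /andP[].
  - have -> : y = t.+2 by lia.
    by rewrite t2 eqxx mul1n add0n => <-.
  - by rewrite t1 (gtn_eqF (ltnSn t.+1)) mul0n => -[]; rewrite add0n => <-.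
rewrite sE /P''_cond rE.
rewrite take_size_cat ?size_nseq // drop_size_cat ?size_nseq // eqxx /=.
rewrite filter_all andbT; apply/uniq_filterP => i ti.
have := us i ti; rewrite sE /=; lia.
Qed.
End Sorted.

(** * Classes sorted out by the largest odd part or by a marked even part *)

Lemma max_odd_mem s : has odd s ->
  odd (\max_(y <- s | odd y) y) && (\max_(y <- s | odd y) y \in s).
Proof.
elim: s => //= x s IHs; rewrite big_cons; case: (boolP (odd x)) => /= [ox _|_ /IHs].
  rewrite inE; case: (boolP (has odd s)) => [/IHs/andP[om ms]|/hasPn no].
    by case: (leqP x) => _; rewrite ?ox ?om ?ms ?eqxx ?orbT.
  by rewrite big_seq_cond big1 ?maxn0 ?ox ?eqxx // => y /andP[/no/negPf->].
by case/andP=> -> ms; rewrite inE ms orbT.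
Qed.

(** If [l < l'], the second pattern demands the part [2l'+1], and the first forbids odd parts above
    [2l+1]. *)
Lemma obeys_B_mults_unique U k l l' s : all (fun y => y < U) s ->
  (2 * l).+1 < U -> (2 * l').+1 < U ->
  obeys U (B_mults k l) s -> obeys U (B_mults k l') s -> l = l'.
Proof.
move=> sU lU l'U /allP bl /allP bl'.
have cl m : m \in [:: l; l'] -> 0 < count_mem (2 * m).+1 s.
  rewrite !inE => /orP[]/eqP->.
    have := bl (2 * l).+1; rewrite mem_iota => /(_ lU).
    by rewrite /B_mults /= oddM /= ltnn eqxx.
  have := bl' (2 * l').+1; rewrite mem_iota => /(_ l'U).
  by rewrite /B_mults /= oddM /= ltnn eqxx.
case: (ltngtP l l') => // ll'.
  have := bl (2 * l').+1; rewrite mem_iota => /(_ l'U).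
  rewrite /B_mults /= oddM /= !ifF; try lia.
  by have := cl l'; rewrite !inE eqxx orbT lt0n => /(_ isT)/negPf->.
have := bl' (2 * l).+1; rewrite mem_iota => /(_ lU).
rewrite /B_mults /= oddM /= !ifF; try lia.
by have := cl l; rewrite !inE eqxx lt0n => /(_ isT)/negPf->.
Qed.

(** The two parities share all other requirements, collected in [base], so their difference is
    [base] with a sign; [base] holds exactly when a pattern does, for a unique [l]. The bound
    [2 * T <= U] places [2l+1] inside the box. *)
Lemma B_condE U T k s : 0 < k -> all (fun y => y < T) s -> 2 * T <= U ->
  (((count_mem 0 s == 0)%N && B_cond k false s)%:R
   - ((count_mem 0 s == 0)%N && B_cond k true s)%:R =
   \sum_(0 <= l < T) (obeys U (B_mults k l) s)%:R * (-1) ^+ count (predC odd) s :> int)%R.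
Proof.
move=> k0 sT TU.
have sU : all (fun y => y < U) s by apply: sub_all sT => y /= yT; lia.
set base := [&& count_mem 0 s == 0, has odd s, uniq [seq x <- s | ~~ odd x]
  & all (fun x => ((\max_(x <- s | odd x) x).+1 + 2 <= x)
      && (x <= (\max_(x <- s | odd x) x).+1 + 2 * k - 2)) [seq x <- s | ~~ odd x]].
have BE (b : bool) : (count_mem 0 s == 0) && B_cond k b s
    = base && (odd (count (predC odd) s) == b).
  by rewrite /B_cond /base /= size_filter !andbA.
rewrite !{}BE.
transitivity (base%:R * (-1) ^+ count (predC odd) s : int)%R.
  rewrite -signr_odd; case: (odd _); case: (base) => //=.
rewrite -mulr_suml; congr (_ * _)%R.
apply: sum_unique => [l l' lT l'T|]; first by apply: obeys_B_mults_unique; lia.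
rewrite /base; set L := \max_(x <- s | odd x) x.
have leL y : odd y -> y \in s -> y <= L by move=> oy ys; apply: (leq_bigmax_seq y).
have bB0 l i : l < T -> U <= i -> B_mults k l i 0.
  by move=> lT Ui; rewrite /B_mults; case: ifP => _; [rewrite !ifF //; lia | case: ifP].
split=> [/and4P[/eqP s0 ho /uniq_filterP ue /allP re]|[l lT]].
  (* The maximum over no odd part would be 0; the presence of an odd part makes [L] an actual part,
     and odd. *)
  have /andP[oL Ls] := max_odd_mem ho; rewrite -/L in oL Ls.
  have LT : L < T by apply: (allP sT).
  have LE : L = (2 * L./2).+1 by rewrite -[LHS]odd_double_half oL mul2n.
  exists L./2; first by lia.
  apply/obeysP => // [i Ui|i]; first by apply: bB0 => //; lia.
  rewrite /B_mults -LE; case: ifP => oi.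
    case: (ltngtP i L) => // [iL|->]; last by rewrite -mem_count.
    by apply/eqP/count_memPn/negP => /(leL _ oi); lia.
  case: ifP => ri; first by apply: ue; rewrite oi.
  apply/eqP/count_memPn/negP => is_; have := re i; rewrite mem_filter oi is_ => /(_ isT).
  by lia.
move=> /obeysP-/(_ (fun i => @bB0 l i lT) sU) bs.
have c0 : count_mem 0 s = 0.
  by have := bs 0; rewrite /B_mults /= ifF => [/eqP|] //; lia.
have ls : (2 * l).+1 \in s.
  by have := bs (2 * l).+1; rewrite /B_mults /= oddM /= ltnn eqxx mem_count.
have ho : has odd s by apply/hasP; exists (2 * l).+1; rewrite //= oddM.
have /andP[oL Ls] := max_odd_mem ho; rewrite -/L in oL Ls.
have LE : L = (2 * l).+1.
  apply/eqP; rewrite eqn_leq leL ?oddM //= ?andbT; last by rewrite oddM.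
  rewrite leqNgt; apply/negP => lL; have := bs L; rewrite /B_mults oL !ifF; try lia.
  by move: Ls; rewrite mem_count; lia.
rewrite c0 ho LE /=; apply/andP; split.
  apply/uniq_filterP => i /negPf oi; have := bs i; rewrite /B_mults oi.
  by case: ifP => // _ /eqP->.
apply/allP => i; rewrite mem_filter mem_count => /andP[/negPf oi].
have := bs i; rewrite /B_mults oi; case: ifP => [|_ /eqP->//].
by move=> /andP[]; lia.
Qed.

(** Pairs are counted, so [l] stays fixed and there is a single pattern; the sum over [l] is the one
    in the definition of [C]. *)
Lemma C_condE U k l s : 0 < k -> 0 < l -> 2 * l < U -> all (fun y => y < U) s ->
  (((count_mem 0 s == 0)%N && C_cond k l false s)%:R
   - ((count_mem 0 s == 0)%N && C_cond k l true s)%:R =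
   (obeys U (C_mults k l) s)%:R * (-1) ^+ count (fun x => 2 * l < x)%N s :> int)%R.
Proof.
move=> k0 l0 lU sU.
set base := [&& count_mem 0 s == 0, 2 * l \in s, uniq [seq x <- s | x <= l],
  uniq [seq x <- s | 2 * l < x]
  & all (fun x => ~~ odd x && (2 * l + 2 <= x) && (x <= 2 * l + 2 * k - 2))
      [seq x <- s | 2 * l < x]].
have CE (b : bool) : (count_mem 0 s == 0) && C_cond k l b s
    = base && (odd (count (fun x => 2 * l < x) s) == b).
  by rewrite /C_cond /base /= size_filter !andbA.
rewrite !{}CE.
transitivity (base%:R * (-1) ^+ count (fun x => 2 * l < x)%N s : int)%R.
  rewrite -signr_odd; case: (odd _); case: (base) => //=.
congr ((nat_of_bool _)%:R * _)%R; rewrite /base.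
have bC0 i : U <= i -> C_mults k l i 0 by move=> Ui; rewrite /C_mults ifF; [case: ifP | lia].
apply/idP/(obeysP bC0 sU) => [/and5P[/eqP s0 ls /uniq_filterP ul /uniq_filterP ub /allP rb] i|bs].
  rewrite /C_mults; case: ifP => [i2l|/negbT i2l].
    case: eqP => [->|/eqP i0]; first by rewrite s0.
    case: ifP => [/ul //|_]; case: ifP => // il.
    by have -> : i = 2 * l; [lia | rewrite -mem_count].
  rewrite -ltnNge in i2l; case: ifP => [_|ri]; first exact: ub.
  apply/eqP/count_memPn/negP => is_; have := rb i; rewrite mem_filter i2l is_ => /(_ isT).
  by move=> /andP[/andP[oi _] ik]; rewrite oi ik in ri.
have c0 : count_mem 0 s = 0 by have := bs 0; rewrite /C_mults /= => /eqP.
have ls : 2 * l \in s.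
  by have := bs (2 * l); rewrite /C_mults leqnn !ifF -?mem_count //; lia.
rewrite c0 ls /=; apply/and3P; split.
- apply/uniq_filterP => i il; have [->|i0] := eqVneq i 0; first by rewrite c0.
  have := bs i; rewrite /C_mults (negPf i0) il ifT //; lia.
- apply/uniq_filterP => i il; have := bs i; rewrite /C_mults leqNgt il /=.
  by case: ifP => // _ /eqP->.
apply/allP => i; rewrite mem_filter mem_count => /andP[il].
have := bs i; rewrite /C_mults leqNgt il /=; case: ifP => [/andP[oi ik] _ _|_ /eqP->//].
by rewrite oi ik andbT /=; lia.
Qed.

End Conditions.

(** * Comparison of coefficients *)

Section CoefficientExtraction.

Local Open Scope ring_scope.

Lemma prod_obeys1 U (b : nat -> nat -> bool) s : all (fun y => y < U)%N s ->
  \prod_(0 <= i < U) (b i (count_mem i s))%:R = (obeys U b s)%:R :> int.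
Proof.
move=> sU; have := @prod_obeys U b pred0 s sU.
rewrite count_pred0 expr0 mulr1 => <-; apply: eq_bigr => i _.
by rewrite mulr1.
Qed.

Lemma B_weightE k l i c : B_weight k l i c = (B_mults k l i c)%:R * (-1) ^+ (predC odd i * c)%N.
Proof.
rewrite /B_weight /B_mults /=; case: (odd i) => /=; first by rewrite mul0n expr0 mulr1.
rewrite mul1n; case: ifP => // _.
by case: c => [|c]; rewrite ?expr0 ?mulr1 ?mul0r.
Qed.

Lemma C_weightE k l i c : C_weight k l i c = (C_mults k l i c)%:R * (-1) ^+ ((2 * l < i)%N * c)%N.
Proof.
rewrite /C_weight /C_mults [(2 * l < i)%N]ltnNge; case: ifP => _ /=.
  by rewrite mul0n expr0 mulr1.
rewrite mul1n; case: ifP => // _.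
by case: c => [|c]; rewrite ?expr0 ?mulr1 ?mul0r.
Qed.

(** The quotient of [{poly int}] by [X^N] provides the nilpotent variable without losing the
    coefficients below [N]. *)
Lemma poly_truncation N : (0 < N)%N ->
  exists (S : comNzRingType) (f : {rmorphism {poly int} -> S}),
    f 'X ^+ N = 0 /\ forall p q, f p = f q -> forall i, (i < N)%N -> p`_i = q`_i.
Proof.
move=> N0; exists {poly %/ ('X^N : {poly int})}, (in_qpoly ('X^N : {poly int})).
split=> [|p q pq i iN]; first exact: in_qpolyXn_exp.
by rewrite -(coef_in_qpolyXn p iN) pq coef_in_qpolyXn.
Qed.

(** * Counting functions as coefficients of generating polynomials *)

Variables k n : nat.
Hypotheses (k_gt0 : (0 < k)%N) (n_gt0 : (0 < n)%N).

(** The bound on multiplicities in the encoding of [D (2 * k) n.+1], the largest of the boxes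
    involved. *)
Let M := (n + 2 * k + 2)%N.

Lemma D_genpoly : (D (2 * k) n.+1)%:R =
  (\sum_(0 <= t < n.+2) genpoly 'X (D_weight t (2 * k)) (2 * M) M)`_n.+1 :> int.
Proof.
rewrite /D pcount0E.
apply: (@sum_mparts_sum_genpoly _ _ _ _ _ _ _ (fun s => (D_cond (2 * k) s)%:R)).
- by rewrite /M; lia.
- by rewrite /M; lia.
- move=> t c tc; rewrite /D_weight /D_mults; case: ifP => _; first by case: eqP => //; lia.
  by case: ifP => _; [case: eqP => // | case: leqP => //]; lia.
move=> s srt sT; rewrite (D_condE srt sT (U := 2 * M)); [|rewrite /M; lia|lia].
apply: eq_bigr => t _; rewrite -prod_obeys1 //.
by apply: sub_all sT => y /=; rewrite /M; lia.
Qed.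

Lemma pcount_genpoly m P T (w : nat -> nat -> nat -> int) : (m < n.+2)%N ->
    (forall t c, w t 0%N c = (c == 0%N)%:R) ->
    (forall s, sorted leq s -> all (fun i => i < m.+1)%N s ->
       ((count_mem 0%N s == 0%N) && P s)%:R
       = \sum_(0 <= t < T) \prod_(0 <= i < 2 * M) w t i (count_mem i s)) ->
  (pcount m P)%:R = (\sum_(0 <= t < T) genpoly 'X (w t) (2 * M) M)`_m :> int.
Proof.
move=> mn w0 PE; rewrite pcountE.
apply: (@sum_mparts_sum_genpoly _ _ _ _ _ _ _
  (fun s => ((count_mem 0%N s == 0%N) && P s)%:R)) => //.
- by rewrite /M; lia.
- by rewrite /M; lia.
by move=> t c mc; rewrite w0; case: eqP => //; lia.
Qed.

Lemma pcount_genpoly1 m P (w : nat -> nat -> int) : (m < n.+2)%N ->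
    (forall c, w 0%N c = (c == 0%N)%:R) ->
    (forall s, sorted leq s -> all (fun i => i < m.+1)%N s ->
       ((count_mem 0%N s == 0%N) && P s)%:R
       = \prod_(0 <= i < 2 * M) w i (count_mem i s)) ->
  (pcount m P)%:R = (genpoly 'X w (2 * M) M)`_m :> int.
Proof.
move=> mn w0 PE; rewrite (@pcount_genpoly _ _ 1 (fun=> w)) ?big_nat1 //.
by move=> s srt sT; rewrite big_nat1 PE.
Qed.

Lemma pcountB_genpoly m P Q T (w : nat -> nat -> nat -> int) : (m < n.+2)%N ->
    (forall t c, (m < c)%N -> w t 0%N c = 0) ->
    (forall s, sorted leq s -> all (fun i => i < m.+1)%N s ->
       ((count_mem 0%N s == 0%N) && P s)%:R - ((count_mem 0%N s == 0%N) && Q s)%:R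
       = \sum_(0 <= t < T) \prod_(0 <= i < 2 * M) w t i (count_mem i s)) ->
  (pcount m P)%:R - (pcount m Q)%:R = (\sum_(0 <= t < T) genpoly 'X (w t) (2 * M) M)`_m :> int.
Proof.
move=> mn w0 PE; rewrite !pcountE -sumrB.
apply: (@sum_mparts_sum_genpoly _ _ _ _ _ _ _
  (fun s => ((count_mem 0%N s == 0%N) && P s)%:R - ((count_mem 0%N s == 0%N) && Q s)%:R)) => //.
- by rewrite /M; lia.
- by rewrite /M; lia.
Qed.

Lemma B_genpoly : (B k false n)%:R - (B k true n)%:R =
  (\sum_(0 <= l < n.+1) genpoly 'X (B_weight k l) (2 * M) M)`_n :> int.
Proof.
apply: pcountB_genpoly => // [t c nc|s srt sT].
  by rewrite /B_weight /= ifF; [case: eqP => //; lia | lia].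
have sU : all (fun y => y < 2 * M)%N s by apply: sub_all sT => y /=; rewrite /M; lia.
rewrite (@B_condE (2 * M) n.+1) //; last by rewrite /M; lia.
apply: eq_bigr => l _; rewrite -prod_obeys //; apply: eq_bigr => i _.
by rewrite B_weightE.
Qed.

Lemma C_genpoly : (C k false n.+1)%:R - (C k true n.+1)%:R =
  (\sum_(1 <= l < n.+2) genpoly 'X (C_weight k l) (2 * M) M)`_n.+1 :> int.
Proof.
rewrite /C !natr_sum -sumrB coef_sum; apply: eq_big_nat => l /andP[l0 ln].
rewrite (@pcountB_genpoly _ _ _ 1 (fun=> C_weight k l)) ?big_nat1 // => [t c nc|s srt sT].
  by rewrite /C_weight /=; case: eqP => //; lia.
have sU : all (fun y => y < 2 * M)%N s by apply: sub_all sT => y /=; rewrite /M; lia.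
rewrite big_nat1 (@C_condE (2 * M)) //; last by rewrite /M; lia.
by rewrite -prod_obeys //; apply: eq_bigr => i _; rewrite C_weightE.
Qed.

(** Index 0 stands for the empty partition, index [t > 0] for smallest part [t]. *)
Definition P2_weight t : nat -> nat -> int :=
  if t is t'.+1 then A_weight t'.+1 0 else fun _ c => (c == 0%N)%:R.

Lemma P1_genpoly : (pcount n P1_cond)%:R = (genpoly 'X (D_weight 1 0) (2 * M) M)`_n :> int.
Proof.
apply: pcount_genpoly1 => // s srt sT.
have sU : all (fun y => y < 2 * M)%N s by apply: sub_all sT => y /=; rewrite /M; lia.
rewrite (@P1_condE (2 * M) n.+1) //; try (rewrite /M; lia).
by rewrite -prod_obeys1.
Qed.

Lemma P'_genpoly j :
  (pcount n (P'_cond j))%:R = (genpoly 'X (D_weight 1 (j - 1)) (2 * M) M)`_n :> int.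
Proof.
apply: pcount_genpoly1 => // s srt sT.
have sU : all (fun y => y < 2 * M)%N s by apply: sub_all sT => y /=; rewrite /M; lia.
rewrite (@P'_condE (2 * M) n.+1) //; try (rewrite /M; lia).
by rewrite -prod_obeys1.
Qed.

Lemma P2_genpoly :
  (pcount n P2_cond)%:R = (\sum_(0 <= t < n.+1) genpoly 'X (P2_weight t) (2 * M) M)`_n :> int.
Proof.
apply: pcount_genpoly => // [[|t] c //|s srt sT].
have sU : all (fun y => y < 2 * M)%N s by apply: sub_all sT => y /=; rewrite /M; lia.
rewrite (@P2_condE (2 * M) n.+1) //; last by rewrite /M; lia.
rewrite big_nat_recl //=; congr (_ + _); first by rewrite -prod_obeys1.
by apply: eq_bigr => t _; rewrite -prod_obeys1.
Qed.

Lemma P''_genpoly j :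
  (pcount n (P''_cond j))%:R =
  (\sum_(0 <= t < n) genpoly 'X (A_weight t.+1 (j - 1)) (2 * M) M)`_n :> int.
Proof.
apply: pcount_genpoly => // s srt sT.
have sU : all (fun y => y < 2 * M)%N s by apply: sub_all sT => y /=; rewrite /M; lia.
rewrite (@P''_condE (2 * M) n.+1) //; last by rewrite /M; lia.
by apply: eq_bigr => t _; rewrite -prod_obeys1.
Qed.

(** * Identities in the truncated ring *)

Variables (S : comNzRingType) (f : {rmorphism {poly int} -> S}).
Hypotheses (xN0 : f 'X ^+ n.+2 = 0)
  (coef_f : forall p q, f p = f q -> forall i, (i < n.+2)%N -> p`_i = q`_i).

Let x := f 'X.

Let leNM : (n.+2 <= M)%N.
Proof. by rewrite /M; lia. Qed.

Lemma rmorph_D_genpoly : f (\sum_(0 <= t < n.+2) genpoly 'X (D_weight t (2 * k)) (2 * M) M)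
  = Dseries x n.+2 M (2 * k).
Proof.
rewrite rmorph_sum; apply: eq_big_nat => t tn.
rewrite rmorph_genpoly (genpoly_D_weight xN0) //; rewrite /M; lia.
Qed.

(** Multiplication by [x] turns [x^(2l+1)] into [x^(2(l+1))], the power in the term of index [l+1];
    this accounts for [n] against [n + 1]. *)
Lemma rmorph_B_genpoly : f ('X * \sum_(0 <= l < n.+1) genpoly 'X (B_weight k l) (2 * M) M)
  = Cseries x n.+2 M k.
Proof.
rewrite rmorphM rmorph_sum mulr_sumr /Cseries big_add1.
apply: eq_big_nat => l ln.
rewrite rmorph_genpoly (genpoly_B_weight xN0) //; try (rewrite /M; lia).
by rewrite -/x mulrA -exprS; congr (_ ^+ _ * _); lia.
Qed.

Lemma rmorph_C_genpoly : f (\sum_(1 <= l < n.+2) genpoly 'X (C_weight k l) (2 * M) M)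
  = Cseries x n.+2 M k.
Proof.
rewrite rmorph_sum; apply: eq_big_nat => l ln.
by rewrite rmorph_genpoly (genpoly_C_weight xN0) //; rewrite /M; lia.
Qed.

(* For [e = 0] this pairs P_1 with P_2, for [e = j - 1] it pairs P'_(j-1) with
   P''_(j-1). *)
Lemma A_weight_series e : (e.+1 < M)%N ->
  x * (genpoly x (D_weight 1 e) (2 * M) M + \sum_(0 <= t < n) genpoly x (A_weight t.+1 e) (2 * M) M)
  = Dseries x n.+2 M e.+1 - distinct x M 1.
Proof.
move=> eM; rewrite (genpoly_D_weight xN0) //; try (rewrite /M; lia).
(* In [Dseries], [m = 0] is cancelled by [distinct 1], [m = 1] is the first summand, and [m = t + 2]
   matches [t], since [1 + (t+1) + (t+2) e = (t+2) (e+1)]. *)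
rewrite /Dseries [in RHS]big_ltn // [in RHS]big_ltn // mul0n expr0 !mul1n mul1r.
rewrite [RHS]addrAC subrr add0r.
rewrite mulrDr mulrA -exprS; congr (_ + _).
rewrite mulr_sumr [RHS]big_add1 [RHS]big_add1 /=; apply: eq_big_nat => t tn.
rewrite (genpoly_A_weight xN0) //; try (rewrite /M; lia).
by rewrite mulrA -exprS; congr (_ ^+ _ * _); lia.
Qed.

Let coef_mulX (p : {poly int}) i : p`_i = ('X * p)`_i.+1.
Proof. by rewrite coefXM. Qed.

(* The empty partition is counted by P_2 and accounts for the summand [q] in
   [2 q A_j = D_j - 1 + q]. *)
Let coef_addX1 (p : {poly int}) : (p + 'X + (-1))`_n.+1 = p`_n.+1.
Proof. by rewrite !coefD coefN coef1 coefX /= subr0 eqSS (gtn_eqF n_gt0) addr0. Qed.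

Lemma sum_P_eq_D :
  ((pcount n P1_cond + pcount n (P'_cond (2 * k)) + pcount n P2_cond
    + pcount n (P''_cond (2 * k)))%N)%:R = (D (2 * k) n.+1)%:R :> int.
Proof.
rewrite !natrD P1_genpoly P'_genpoly P2_genpoly P''_genpoly D_genpoly -!coefD.
rewrite coef_mulX -[RHS]coef_addX1; apply: coef_f => //.
rewrite !rmorphD rmorphN1 rmorph_D_genpoly rmorphM big_nat_recl // !rmorphD !rmorph_sum.
rewrite !rmorph_genpoly /= -/x.
under eq_bigr do rewrite rmorph_genpoly.
under [X in _ + X]eq_bigr do rewrite rmorph_genpoly.
rewrite (genpoly_empty x leNM) //.
have e0 := @A_weight_series 0; have ek := @A_weight_series (2 * k - 1).
rewrite (_ : (2 * k - 1).+1 = 2 * k)%N in ek; last by lia.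
(* With [d = distinct 1], P_1 and P_2 together give [D_1 - d + x], where [x] stems from the empty
   partition, and the other two give [D_2k - d]; as [D_1 = 2 d - 1], the sum is [D_2k + x - 1]. *)
transitivity (Dseries x n.+2 M 1 - distinct x M 1 + x
  + (Dseries x n.+2 M (2 * k) - distinct x M 1)).
  rewrite -e0 -?ek; try (rewrite /M; lia).
  ring.
rewrite (Fser1 xN0) //; ring.
Qed.

Lemma D_eq_C_diff : (k * (2 * k - 1) <= n)%N ->
  (D (2 * k) n.+1)%:R = 2 * ((C k false n.+1)%:R - (C k true n.+1)%:R) :> int.
Proof.
move=> kn; rewrite C_genpoly D_genpoly; set c : {poly int} := \sum_(1 <= l < _) _.
(* The correction has degree at most [k (2k - 1) <= n], so its coefficient at [n + 1] is 0. *)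
have -> : 2 * c`_n.+1 = (2 * c + correction 'X k.-1)`_n.+1.
  rewrite [in RHS]mulr_natl coefD coefMn mulr_natl [X in _ + X]nth_default ?addr0 //.
  by apply: leq_trans (size_correction _) _; nia.
apply: coef_f => //.
rewrite rmorph_D_genpoly rmorphD rmorphM rmorph_nat rmorph_C_genpoly rmorph_correction.
by rewrite -(Dseries_Cseries _ xN0) // prednK.
Qed.

Lemma B_diff_eq_C_diff : (B k false n)%:R - (B k true n)%:R
  = (C k false n.+1)%:R - (C k true n.+1)%:R :> int.
Proof.
rewrite B_genpoly C_genpoly coef_mulX.
by apply: coef_f => //; rewrite rmorph_B_genpoly rmorph_C_genpoly.
Qed.

End CoefficientExtraction.

Theorem theorem5 (k n : nat) :
  1 <= k -> 2 ^ (k - 1) * k * (2 * k - 1) <= n ->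
  let Bdiff : rat := ((B k false n)%:R - (B k true n)%:R)%R in
  let Cdiff : rat := ((C k false n.+1)%:R - (C k true n.+1)%:R)%R in
  [/\ A (2 * k) n = Bdiff, Bdiff = Cdiff & Cdiff = ((D (2 * k) n.+1)%:R / 2)%R].
Proof.
move=> k_gt0 bound.
have kn : k * (2 * k - 1) <= n.
  by apply: leq_trans bound; rewrite -mulnA leq_pmull // expn_gt0.
have n_gt0 : 0 < n by nia.
(* Truncation at [n + 2] keeps the coefficient of index [n + 1]. *)
have [S [f [xN0 coef_f]]] := poly_truncation (ltn0Sn n.+1).
have AD := sum_P_eq_D k_gt0 n_gt0 xN0 coef_f.
have BC := congr1 (fun z : int => z%:~R : rat)%R (B_diff_eq_C_diff k_gt0 n_gt0 xN0 coef_f).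
have DC := congr1 (fun z : int => z%:~R : rat)%R (D_eq_C_diff k_gt0 n_gt0 xN0 coef_f kn).
move=> Bdiff Cdiff.
have eBC : Bdiff = Cdiff by move: BC; rewrite /= !rmorphB /= !rmorph_nat.
have eDC : (Cdiff = (D (2 * k) n.+1)%:R / 2)%R.
  move: DC; rewrite /= rmorphM rmorphB !rmorph_nat => ->.
  by rewrite mulrC mulKf.
split=> //; rewrite eBC eDC /A; congr (_%:R / _)%R.
by move/eqP: AD; rewrite eqr_nat => /eqP.
Qed.
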